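(* Let $F\in\mathbb{R}^{n\times n}$, $G\in\mathbb{R}^{n\times m}$, $H\in\mathbb{R}^{n\times p}$ with $H\ne0$, $E_1\in\mathbb{R}^{l\times n}$, $E_2\in\mathbb{R}^{l\times m}$, let $K_k\in\mathbb{R}^{m\times n}$ be guaranteed cost control gains, let $\widetilde K\in\mathbb{R}^{m\times n}$ be arbitrary and $\widetilde F=F-G\widetilde K$. For a time step $k\ge 0$ let the constraint set be the non-empty polyhedral set $\mathcal{C}_k=\{[x^T,u^T]^T\in\mathbb{R}^{n+m} : A_kx+B_ku+c_k\le 0\}$ with $A_k\in\mathbb{R}^{q\times n}$, $B_k\in\mathbb{R}^{q\times m}$, $c_k\in\mathbb{R}^q$, and let $\widetilde A_k=A_k-B_kK_k$. Let $\bar\phi_j(\mathbf{x},\mathbf{v})$ be the functions defined in the context, where $\mathbf{x}=(x_0,\dots,x_k)$, $\mathbf{v}=(v_0,\dots,v_k)$, $x_j\in\mathbb{R}^n$, $v_j\in\mathbb{R}^m$. Let $\bar{\mathcal C}_k$ be the robust counterpart of $\mathcal{C}_k$ by explicit maximization, i.e. the set of $[x_k^T,v_k^T]^T$ (given the earlier $x_0,\dots,x_{k-1},v_0,\dots,v_{k-1}$) such that $$\widetilde A_kx_k+B_kv_k+c_k+\widetilde A_k\sum_{j=0}^{k-1}\widetilde F^{\,k-j-1}Hw_j\le 0$$ componentwise for all $w_0,\dots,w_{k-1}\in\mathbb{R}^p$ with $\|w_j\|_2\le\bar\phi_j(\mathbf{x},\mathbf{v})$ for $j=0,\dots,k-1$.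 Then $$\bar{\mathcal C}_k=\Big\{[x_k^T,v_k^T]^T : x_k\in\mathbb{R}^n,\ v_k\in\mathbb{R}^m,\ \forall i\in\{1,\dots,q\},\ \widetilde A_k^{(i)}x_k+B_k^{(i)}v_k+c_k^{(i)}+\Phi_{k,i}(\mathbf{x},\mathbf{v})\le 0\Big\},$$ where $$\Phi_{k,i}(\mathbf{x},\mathbf{v})=\sum_{j=0}^{k-1}\big\|\widetilde A_k^{(i)}\widetilde F^{\,k-j-1}H\big\|_2\,\bar\phi_j(\mathbf{x},\mathbf{v})$$ and $\widetilde A_k^{(i)}$, $B_k^{(i)}$, $c_k^{(i)}$ denote the $i$-th rows of $\widetilde A_k$, $B_k$ and $c_k$.
   Context: Setting: the uncertain system is $\bar x_{k+1}=(F+\delta F_k)\bar x_k+(G+\delta G_k)u_k$ with $[\delta F_k\ \ \delta G_k]=H\Delta_k[E_1\ \ E_2]$, $\Delta_k\in\mathbb{R}^{p\times l}$, $\|\Delta_k\|_2\le1$; $x_k$ is the state of the nominal system $x_{k+1}=Fx_k+Gu_k$, and the constraints are considered with $u_k=-K_kx_k+v_k$. Guaranteed cost control: let $Q\succeq0$, $R\succ0$ be symmetric weights and $N$ a horizon. Gains $K_k$ are guaranteed cost control gains if there are symmetric $S_k\succeq 0$, $0\le k\le N$, such that for all $0\le k\le N-1$ and all $\Delta_k$ with $\|\Delta_k\|_2\le 1$, with $M=F-GK_k+\delta F_k-\delta G_kK_k$, one has $M^TS_{k+1}M-S_k+Q+K_k^TRK_k\prec0$. Definition of $\bar\phi_j$: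 let $\widetilde E_{1,k}=E_1-E_2K_k$, $\phi_k(x,v)=\|\widetilde E_{1,k}x+E_2v\|_2$, and $\rho_i=\|E_1\widetilde F^{\,i}H\|_2$. For integers $0\le i<k$ define recursively $$c(k,i)=\rho_{k-i-1}+\sum_{j=0}^{k-i-2}\rho_j\,c(k-j-1,i)$$ (empty sums are zero; these scalars are unrelated to the constraint vectors $c_k$). Then $$\bar\phi_k(\mathbf{x},\mathbf{v})=\phi_k(x_k,v_k)+\sum_{i=0}^{k-1}c(k,i)\,\phi_i(x_i,v_i).$$ $\|\cdot\|_2$ is the Euclidean norm of vectors and the induced (spectral) norm of matrices; for a row vector it is the Euclidean norm. *)

(* Defs.v *)
From mathcomp Require Import all_boot all_order all_algebra.
From mathcomp Require Import all_classical all_reals.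
From mathcomp Require Import zify.

Set Implicit Arguments.
Unset Strict Implicit.
Unset Printing Implicit Defensive.

Import Order.TTheory GRing.Theory Num.Theory.
Local Open Scope classical_set_scope.
Local Open Scope ring_scope.

(* Euclidean norm; the canonical norm `|A| on matrices is the max norm. *)
Definition norm2 (R : realType) (n : nat) (x : 'cV[R]_n) : R :=
  Num.sqrt (\sum_(i < n) x i 0 ^+ 2).

Definition rnorm2 (R : realType) (n : nat) (a : 'rV[R]_n) : R := norm2 a^T.

(* The defining set is bounded and contains 0, also when m or n is 0, so the
   supremum is never a junk value. *)
Definition mxnorm2 (R : realType) (m n : nat) (A : 'M[R]_(m, n)) : R :=
  sup [set norm2 (A *m x) | x in [set x : 'cV[R]_n | norm2 x <= 1]].

Definition quad (R : realType) (n : nat) (A : 'M[R]_n) (x : 'cV[R]_n) : R :=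
  (x^T *m A *m x) 0 0.

Definition psdmx (R : realType) (n : nat) (A : 'M[R]_n) : Prop :=
  A^T = A /\ forall x : 'cV[R]_n, 0 <= quad A x.

Definition pdmx (R : realType) (n : nat) (A : 'M[R]_n) : Prop :=
  A^T = A /\ forall x : 'cV[R]_n, x != 0 -> 0 < quad A x.

Definition ndmx (R : realType) (n : nat) (A : 'M[R]_n) : Prop := pdmx (- A).

(* Only K 0, ..., K (N - 1) and S 0, ..., S N are constrained. *)
Definition guaranteed_cost_gains (R : realType) (n m p l : nat)
    (F : 'M[R]_n) (G : 'M[R]_(n, m)) (H : 'M[R]_(n, p))
    (E1 : 'M[R]_(l, n)) (E2 : 'M[R]_(l, m))
    (Q : 'M[R]_n) (Rw : 'M[R]_m) (N : nat) (K : nat -> 'M[R]_(m, n)) : Prop :=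
  exists S : nat -> 'M[R]_n,
    (forall k : nat, (k <= N)%N -> psdmx (S k)) /\
    (forall k : nat, (k < N)%N ->
     forall (Delta : 'M[R]_(p, l)) (dF : 'M[R]_n) (dG : 'M[R]_(n, m)),
       mxnorm2 Delta <= 1 ->
       row_mx dF dG = H *m Delta *m row_mx E1 E2 ->
       let M := F - G *m K k + dF - dG *m K k in
       ndmx (M^T *m S k.+1 *m M - S k + Q + (K k)^T *m Rw *m K k)).

(* [fuel] makes the recursion structural; see [coefE]. *)
Fixpoint coef_fuel (R : realType) (rho : nat -> R) (fuel k i : nat) : R :=
  if fuel is f.+1 then
    rho (k - i - 1)%N
    + \sum_(j < k - i - 1) rho j * coef_fuel rho f (k - j - 1) i
  else 0.

Definition coef (R : realType) (rho : nat -> R) (k i : nat) : R :=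
  coef_fuel rho k k i.

Lemma coef_fuel_indep (R : realType) (rho : nat -> R) (f g k i : nat) :
  (i < k)%N -> (k <= f)%N -> (k <= g)%N ->
  coef_fuel rho f k i = coef_fuel rho g k i.
Proof.
elim: f g k => [|f IH] [|g] k ik kf kg; try lia.
rewrite /=; congr (_ + _); apply: eq_bigr => -[j jk] _ /=; congr (_ * _).
apply: IH; lia.
Qed.

Lemma coefE (R : realType) (rho : nat -> R) (k i : nat) : (i < k)%N ->
  coef rho k i =
  rho (k - i - 1)%N + \sum_(j < k - i - 1) rho j * coef rho (k - j - 1) i.
Proof.
rewrite /coef; case: k => // k ik.
rewrite [LHS]/=; congr (_ + _); apply: eq_bigr => -[j jk] _ /=.
congr (_ * _); apply: coef_fuel_indep; lia.
Qed.

Definition phi (R : realType) (n m l : nat)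
    (E1 : 'M[R]_(l, n)) (E2 : 'M[R]_(l, m)) (K : nat -> 'M[R]_(m, n))
    (k : nat) (x : 'cV[R]_n) (v : 'cV[R]_m) : R :=
  norm2 ((E1 - E2 *m K k) *m x + E2 *m v).

Definition rho (R : realType) (n p l : nat)
    (E1 : 'M[R]_(l, n)) (Ft : 'M[R]_n) (H : 'M[R]_(n, p)) (i : nat) : R :=
  mxnorm2 (E1 *m Ft ^+ i *m H).

Definition phibar (R : realType) (n m p l : nat)
    (H : 'M[R]_(n, p)) (E1 : 'M[R]_(l, n)) (E2 : 'M[R]_(l, m))
    (K : nat -> 'M[R]_(m, n)) (Ft : 'M[R]_n) (k : nat)
    (x : nat -> 'cV[R]_n) (v : nat -> 'cV[R]_m) : R :=
  phi E1 E2 K k (x k) (v k)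
  + \sum_(i < k) coef (rho E1 Ft H) k i * phi E1 E2 K i (x i) (v i).

(* The sequence s_0, ..., s_(k-1), y (constant from index k on). *)
Definition extend (T : Type) (k : nat) (s : 'I_k -> T) (y : T) (j : nat) : T :=
  if insub j is Some i then s i else y.

Definition polyhedron (R : realType) (n m q : nat)
    (A : 'M[R]_(q, n)) (B : 'M[R]_(q, m)) (c : 'cV[R]_q) :
    set 'cV[R]_(n + m) :=
  [set z | exists (x : 'cV[R]_n) (u : 'cV[R]_m),
     z = col_mx x u /\ forall i : 'I_q, (A *m x + B *m u + c) i 0 <= 0].

Definition robust_counterpart (R : realType) (n m p l q : nat)
    (H : 'M[R]_(n, p)) (E1 : 'M[R]_(l, n)) (E2 : 'M[R]_(l, m))
    (K : nat -> 'M[R]_(m, n)) (Ft : 'M[R]_n) (k : nat)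
    (At : 'M[R]_(q, n)) (B : 'M[R]_(q, m)) (c : 'cV[R]_q)
    (x : 'I_k -> 'cV[R]_n) (v : 'I_k -> 'cV[R]_m) : set 'cV[R]_(n + m) :=
  [set z | exists (xk : 'cV[R]_n) (vk : 'cV[R]_m), z = col_mx xk vk /\
     forall w : 'I_k -> 'cV[R]_p,
       (forall j : 'I_k,
          norm2 (w j) <= phibar H E1 E2 K Ft j (extend x xk) (extend v vk)) ->
       forall i : 'I_q,
         (At *m xk + B *m vk + c
          + At *m \sum_(j < k) Ft ^+ (k - j - 1) *m H *m w j) i 0 <= 0].

Definition Phi (R : realType) (n m p l q : nat)
    (H : 'M[R]_(n, p)) (E1 : 'M[R]_(l, n)) (E2 : 'M[R]_(l, m))
    (K : nat -> 'M[R]_(m, n)) (Ft : 'M[R]_n) (k : nat)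
    (At : 'M[R]_(q, n)) (i : 'I_q)
    (x : nat -> 'cV[R]_n) (v : nat -> 'cV[R]_m) : R :=
  \sum_(j < k) rnorm2 (row i At *m Ft ^+ (k - j - 1) *m H)
               * phibar H E1 E2 K Ft j x v.

(* Main.v *)
(* A linear functional w |-> a w on the Euclidean ball of radius b >= 0 has
   maximum |a|_2 b (Cauchy-Schwarz, attained at w = (b / |a|_2) a^T).  Each
   constraint row involves w_0, ..., w_(k-1) as a sum of such functionals over
   independent balls, so its maximum is the sum of these maxima.  The radii are
   nonnegative because the coefficients c(k, i) are. *)

Require Import Defs.
From mathcomp Require Import all_boot all_order all_algebra.
From mathcomp Require Import all_classical all_reals.
From mathcomp Require Import ring lra.

Import Order.TTheory GRing.Theory Num.Theory.
Local Open Scope classical_set_scope.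
Local Open Scope ring_scope.

Lemma norm2_ge0 (R : realType) (n : nat) (x : 'cV[R]_n) : 0 <= norm2 x.
Proof. exact: sqrtr_ge0. Qed.

Lemma norm2_sqr (R : realType) (n : nat) (x : 'cV[R]_n) :
  norm2 x ^+ 2 = \sum_(i < n) x i 0 ^+ 2.
Proof. by rewrite sqr_sqrtr // sumr_ge0 // => i _; exact: sqr_ge0. Qed.

Lemma norm2_eq0 (R : realType) (n : nat) (x : 'cV[R]_n) :
  norm2 x = 0 -> x = 0.
Proof.
move=> x0; have /eqP := norm2_sqr R n x.
rewrite x0 expr0n /= eq_sym psumr_eq0; last by move=> i _; exact: sqr_ge0.
move=> /allP xi0; apply/colP => i; rewrite mxE.
by apply/eqP; rewrite -sqrf_eq0; apply: (xi0 i); rewrite mem_index_enum.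
Qed.

Lemma norm20 (R : realType) (n : nat) : norm2 (0 : 'cV[R]_n) = 0.
Proof.
by rewrite /norm2 big1 ?sqrtr0 // => i _; rewrite mxE expr0n.
Qed.

Lemma norm2Z (R : realType) (n : nat) (t : R) (x : 'cV[R]_n) :
  norm2 (t *: x) = `|t| * norm2 x.
Proof.
rewrite /norm2 (eq_bigr (fun i => t ^+ 2 * x i 0 ^+ 2)); last first.
  by move=> i _; rewrite mxE exprMn.
by rewrite -mulr_sumr sqrtrM ?sqr_ge0 // sqrtr_sqr.
Qed.

Lemma rnorm2_sqr (R : realType) (n : nat) (a : 'rV[R]_n) :
  rnorm2 a ^+ 2 = (a *m a^T) 0 0.
Proof.
by rewrite norm2_sqr mxE; apply: eq_bigr => i _; rewrite !mxE expr2.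
Qed.

(** Cauchy-Schwarz: the squared norm of [norm2 w *: a^T - rnorm2 a *: w] expands to
    [2 * t * (t - (a *m w) 0 0)] with [t = rnorm2 a * norm2 w]. It is nonnegative, and [t] can be
    cancelled once the cases of zero norm are set aside. *)
Lemma mulmx_le_norm2 (R : realType) (n : nat) (a : 'rV[R]_n) (w : 'cV[R]_n) :
  (a *m w) 0 0 <= rnorm2 a * norm2 w.
Proof.
have [a0|a_neq0] := eqVneq (rnorm2 a) 0.
  by rewrite a0 mul0r -(trmxK a) (norm2_eq0 _ _ _ a0) trmx0 mul0mx mxE.
have [w0|w_neq0] := eqVneq (norm2 w) 0.
  by rewrite w0 mulr0 (norm2_eq0 _ _ _ w0) mulmx0 mxE.
have aw_gt0 : 0 < rnorm2 a * norm2 w.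
  by rewrite mulr_gt0 // lt_def ?a_neq0 ?w_neq0 norm2_ge0.
have := norm2_sqr _ _ (norm2 w *: a^T - rnorm2 a *: w).
rewrite (eq_bigr (fun i => norm2 w ^+ 2 * a^T i 0 ^+ 2
  - (rnorm2 a * norm2 w) * 2 * (a 0 i * w i 0)
  + rnorm2 a ^+ 2 * w i 0 ^+ 2)); last by move=> i _; rewrite !mxE; ring.
rewrite big_split sumrB -!mulr_sumr -!norm2_sqr -/(rnorm2 a) /= => sq.
have := sqr_ge0 (norm2 (norm2 w *: a^T - rnorm2 a *: w)).
rewrite sq => sq_ge0; rewrite mxE -(ler_pM2l aw_gt0); lra.
Qed.

Lemma mulmx_norm2_attained (R : realType) (n : nat) (a : 'rV[R]_n) (b : R) :
  0 <= b -> exists2 w : 'cV[R]_n, norm2 w <= b & (a *m w) 0 0 = rnorm2 a * b.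
Proof.
move=> b_ge0; have [a0|a_neq0] := eqVneq (rnorm2 a) 0.
  by exists 0; rewrite ?norm20 // mulmx0 mxE a0 mul0r.
exists ((b / rnorm2 a) *: a^T).
  by rewrite norm2Z ger0_norm ?divr_ge0 ?norm2_ge0 // -/(rnorm2 a) divfK.
by rewrite -scalemxAr mxE -rnorm2_sqr expr2 mulrA divfK // mulrC.
Qed.

Lemma robust_linear_constraint (R : realType) (p k : nat) (s : R)
    (a : 'I_k -> 'rV[R]_p) (b : 'I_k -> R) :
  (forall j, 0 <= b j) ->
  (forall w : 'I_k -> 'cV[R]_p, (forall j, norm2 (w j) <= b j) ->
     s + \sum_(j < k) (a j *m w j) 0 0 <= 0) <->
  s + \sum_(j < k) rnorm2 (a j) * b j <= 0.
Proof.
move=> b_ge0; split=> [robust|bound w wb].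
  (* Each bound concerns a single [w j], so the separately chosen maximizers together form one
     admissible family [w], which turns every summand into its maximum at once. *)
  have /choice[w aw] : forall j, exists w : 'cV[R]_p,
      norm2 w <= b j /\ (a j *m w) 0 0 = rnorm2 (a j) * b j.
    by move=> j; have [w] := mulmx_norm2_attained R p (a j) (b j) (b_ge0 j); exists w.
  rewrite -(eq_bigr _ (fun j _ => (aw j).2)).
  by apply: robust => j; exact: (aw j).1.
apply: le_trans bound; rewrite lerD2l; apply: ler_sum => j _.
by apply: le_trans (mulmx_le_norm2 _ _ _ _) _; rewrite ler_wpM2l ?norm2_ge0.
Qed.

Lemma mxnorm2_ge0 (R : realType) (m n : nat) (A : 'M[R]_(m, n)) :
  0 <= mxnorm2 A.
Proof.
rewrite /mxnorm2; set S := [set _ | _ in _].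
(* Without a supremum, [sup] takes the default value 0. Otherwise it dominates the element of [S]
   given by the zero vector. *)
have [supS|/sup_out->//] := pselect (has_sup S).
have S0 : S (norm2 (A *m 0)) by exists 0; rewrite //= norm20 ler01.
by apply: le_trans (norm2_ge0 _ _ _) (ub_le_sup supS.2 S0).
Qed.

Lemma coef_ge0 (R : realType) (r : nat -> R) (k i : nat) :
  (forall j, 0 <= r j) -> 0 <= coef r k i.
Proof.
(* Only the fuel is generalized: the induction runs on it, while [k] stays free because the
   recursive calls change it. *)
move=> r_ge0; rewrite /coef; move: {1}k => f.
elim: f k => //= f IH k; rewrite addr_ge0 ?sumr_ge0 // => j _.
by rewrite mulr_ge0.
Qed.

Lemma phibar_ge0 (R : realType) (n m p l : nat)
    (H : 'M[R]_(n, p)) (E1 : 'M[R]_(l, n)) (E2 : 'M[R]_(l, m))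
    (K : nat -> 'M[R]_(m, n)) (Ft : 'M[R]_n) (k : nat)
    (x : nat -> 'cV[R]_n) (v : nat -> 'cV[R]_m) :
  0 <= phibar H E1 E2 K Ft k x v.
Proof.
rewrite addr_ge0 ?norm2_ge0 ?sumr_ge0 // => i _.
by rewrite mulr_ge0 ?norm2_ge0 ?coef_ge0 // => j; exact: mxnorm2_ge0.
Qed.

(** Brings one row of the constraint into the form treated by [robust_linear_constraint]: a part
    free of [w] plus one linear functional in each [w j]. *)
Lemma constraint_rowE (R : realType) (n m p q k : nat) (A : 'M[R]_(q, n))
    (B : 'M[R]_(q, m)) (c : 'cV[R]_q) (M : 'I_k -> 'M[R]_(n, p))
    (x : 'cV[R]_n) (v : 'cV[R]_m) (w : 'I_k -> 'cV[R]_p) (i : 'I_q) :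
  (A *m x + B *m v + c + A *m \sum_(j < k) M j *m w j) i 0 =
  (row i A *m x) 0 0 + (row i B *m v) 0 0 + c i 0
  + \sum_(j < k) (row i A *m M j *m w j) 0 0.
Proof.
rewrite -!row_mul !mxE; congr (_ + _).
transitivity ((row i A *m \sum_(j < k) M j *m w j) 0 0).
  by rewrite -row_mul !mxE.
by rewrite mulmx_sumr summxE; apply: eq_bigr => j _; rewrite mulmxA.
Qed.

Theorem theorem3 (R : realType) (n m p l q : nat)
    (F : 'M[R]_n) (G : 'M[R]_(n, m)) (H : 'M[R]_(n, p))
    (E1 : 'M[R]_(l, n)) (E2 : 'M[R]_(l, m))
    (Q : 'M[R]_n) (Rw : 'M[R]_m) (N : nat)
    (K : nat -> 'M[R]_(m, n)) (Kt : 'M[R]_(m, n)) (k : nat)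
    (A : 'M[R]_(q, n)) (B : 'M[R]_(q, m)) (c : 'cV[R]_q)
    (x : 'I_k -> 'cV[R]_n) (v : 'I_k -> 'cV[R]_m)
    (H_neq0 : H != 0) (Q_psd : psdmx Q) (Rw_pd : pdmx Rw)
    (K_gcc : guaranteed_cost_gains F G H E1 E2 Q Rw N K)
    (C_neq0 : polyhedron A B c !=set0) :
  let Ft := F - G *m Kt in
  let At := A - B *m K k in
  robust_counterpart H E1 E2 K Ft At B c x v =
  [set z : 'cV[R]_(n + m) |
     exists (xk : 'cV[R]_n) (vk : 'cV[R]_m), z = col_mx xk vk /\
       forall i : 'I_q,
         (row i At *m xk) 0 0 + (row i B *m vk) 0 0 + c i 0
         + Phi H E1 E2 K Ft k At i (extend x xk) (extend v vk) <= 0].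
Proof.
move=> Ft At.
(* Once [xk] and [vk] are fixed, the radii are constants independent of [w]. The quantifiers over
   [w] and [i] commute, so each row can be maximized separately, with its own worst [w]. *)
have rowP (xk : 'cV[R]_n) (vk : 'cV[R]_m) (i : 'I_q) :=
  robust_linear_constraint R p k
    ((row i At *m xk) 0 0 + (row i B *m vk) 0 0 + c i 0)
    (fun j => row i At *m Ft ^+ (k - j - 1) *m H) _
    (fun j => phibar_ge0 R n m p l H E1 E2 K Ft j (extend x xk) (extend v vk)).
apply/seteqP; split=> _ [xk [vk [-> zP]]]; exists xk, vk; split=> //.
  move=> i; apply/rowP => w wP; move: (zP w wP i).
  (* Reassociation turns [row i At *m (Ft ^+ _ *m H)] into the row vector whose norm occurs in
     [Phi]. *)
  by rewrite constraint_rowE; under eq_bigr do rewrite mulmxA.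
move=> w wP i; rewrite constraint_rowE; under eq_bigr do rewrite mulmxA.
by move: w wP; apply/rowP; exact: zP.
Qed.
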